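(* Let $W:[0,1]^2\to[0,1]$ be a graphon that admits strong spectral decomposition. Then the exchangeable random graph generated by $W$ can be generated by a graph root distribution on $\mathcal K$; that is, there exists a graph root distribution $F$ on $\mathcal K$ such that the random array $\mathbf A=(A_{ij})_{i,j\ge 1}$ produced by graph root sampling with $F$ has the same distribution as the random array produced by graphon sampling with $W$.
   Context: Graphon: a symmetric measurable function $W:[0,1]^2\to[0,1]$. Graphon sampling with $W$: draw $(s_i)_{i\ge1}$ iid uniform on $[0,1]$; given these, draw $A_{ij}$, $i<j$, independently from Bernoulli distributions with parameter $W(s_i,s_j)$; set $A_{ji}=A_{ij}$ and $A_{ii}=0$. Strong spectral decomposition: view $W$ as the (Hilbert-Schmidt, self-adjoint) integral operator $(Wf)(\cdot)=\int_{[0,1]}W(\cdot,s)f(s)\,ds$ on $L^2([0,1])$, with spectral decomposition $W(s,s')=\sum_{j\ge1}\lambda_j\phi_j(s)\phi_j(s')-\sum_{j\ge1}\gamma_j\psi_j(s)\psi_j(s')$ (convergence in $L^2$), where $\lambda_1\ge\lambda_2\ge\dots>0$ are the positive eigenvalues, $\gamma_1\ge\gamma_2\ge\dots>0$ are the absolute values of the negative eigenvalues (counted with multiplicity; either list may be finite or empty), and the eigenfunctions $(\phi_j)\cup(\psi_j)$ are orthonormal in $L^2([0,1])$. $W$ admits strong spectral decomposition if $\sum_{j\ge1}[\lambda_j\phi_j^2(s)+\gamma_j\psi_j^2(s)]<\infty$ for almost every $s\in[0,1]$. Krein space: $\mathcal H_+=\mathcal H_-=\{x\in\mathbb R^\infty:\sum_j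 x_j^2<\infty\}$ with the usual inner product, and $\mathcal K=\mathcal H_+\ominus\mathcal H_-$ is the set of pairs $(x,y)$, $x\in\mathcal H_+$, $y\in\mathcal H_-$, with indefinite inner product $\langle(x,y),(x',y')\rangle_{\mathcal K}=\langle x,x'\rangle_{\mathcal H_+}-\langle y,y'\rangle_{\mathcal H_-}$, norm $\|(x,y)\|=(\|x\|^2+\|y\|^2)^{1/2}$, and the Borel $\sigma$-field of this norm. Graph root distribution (GRD): a Borel probability measure $F$ on $\mathcal K$ such that $\mathbb P(\langle Z_1,Z_2\rangle_{\mathcal K}\in[0,1])=1$ for independent $Z_1,Z_2\sim F$. Graph root sampling with $F$: draw $(Z_i)_{i\ge1}$ iid from $F$; given these, draw $A_{ij}$, $i<j$, independently from Bernoulli distributions with parameter $\langle Z_i,Z_j\rangle_{\mathcal K}$; set $A_{ji}=A_{ij}$ and $A_{ii}=0$. *)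

(* Defs.v *)
From HB Require Import structures.
From mathcomp Require Import all_boot all_order all_algebra.
From mathcomp Require Import all_classical all_reals all_analysis.
From mathcomp Require Import ring lra.
Set Implicit Arguments.
Unset Strict Implicit.
Unset Printing Implicit Defensive.
Import Order.TTheory GRing.Theory Num.Theory.
Import numFieldNormedType.Exports.

Local Open Scope classical_set_scope.
Local Open Scope ring_scope.

(* Functions on [0, 1] (resp. [0, 1]^2) are total functions on R (resp. R^2)
   of which only the restriction matters; measurability is Borel. *)
Notation unit_itv R := (`[0%R : R, 1%R : R]%classic).

Definition graphon (R : realType) (W : R -> R -> R) : Prop :=
  [/\ measurable_fun (unit_itv R `*` unit_itv R) (fun z : R * R => W z.1 z.2),
      forall x y, unit_itv R x -> unit_itv R y -> W x y = W y x &
      forall x y, unit_itv R x -> unit_itv R y -> 0 <= W x y <= 1].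

Section spectral.
Context {R : realType}.
Local Notation mu := (@lebesgue_measure R).

Definition graphon_op (W : R -> R -> R) (f : R -> R) (t : R) : R :=
  \int[mu]_(s in unit_itv R) (W t s * f s).

Definition square_integrable (f : R -> R) : Prop :=
  measurable_fun (unit_itv R) f /\
  mu.-integrable (unit_itv R) (fun s => (f s ^+ 2)%:E).

Definition L2_dot (f g : R -> R) : R := \int[mu]_(s in unit_itv R) (f s * g s).

Definition eigenfunction (W : R -> R -> R) (l : R) (f : R -> R) : Prop :=
  square_integrable f /\
  \forall t \ae mu, unit_itv R t -> graphon_op W f t = l * f t.

Definition partial_expansion (lam gam : nat -> R) (phi psi : nat -> R -> R)
    (n : nat) (s s' : R) : R :=
  \sum_(0 <= j < n) lam j * phi j s * phi j s' -
  \sum_(0 <= j < n) gam j * psi j s * psi j s'.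

(* A finite (or empty) list of eigenvalues is padded with zeros: the list of
   positive eigenvalues consists of the [lam j] with [0 < lam j], which form an
   initial segment as [lam] is nonincreasing, and [phi j] is unconstrained (and
   contributes nothing to any sum) when [lam j = 0]; likewise for [gam], [psi].
   As the expansion converges to W in L^2, the two lists are necessarily
   complete: every nonzero eigenvalue occurs with its full multiplicity. *)
Record spectral_decomposition (W : R -> R -> R) (lam gam : nat -> R)
    (phi psi : nat -> R -> R) : Prop := {
  lam_ge0 : forall j, 0 <= lam j ;
  gam_ge0 : forall j, 0 <= gam j ;
  lam_nonincreasing : nonincreasing_seq lam ;
  gam_nonincreasing : nonincreasing_seq gam ;
  phi_eigen : forall j, 0 < lam j -> eigenfunction W (lam j) (phi j) ;
  psi_eigen : forall j, 0 < gam j -> eigenfunction W (- gam j) (psi j) ;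
  phi_orthonormal : forall i j, 0 < lam i -> 0 < lam j ->
    L2_dot (phi i) (phi j) = (i == j)%:R ;
  psi_orthonormal : forall i j, 0 < gam i -> 0 < gam j ->
    L2_dot (psi i) (psi j) = (i == j)%:R ;
  phi_psi_orthogonal : forall i j, 0 < lam i -> 0 < gam j ->
    L2_dot (phi i) (psi j) = 0 ;
  expansion_cvg :
    (\int[(mu \x mu)%E]_(z in unit_itv R `*` unit_itv R)
       ((W z.1 z.2 - partial_expansion lam gam phi psi n z.1 z.2) ^+ 2)%:E)%E
      @[n --> \oo] --> 0%E }.

(* Another choice of eigenfunctions alters the sum below only on a null set,
   so that some decomposition satisfies the condition iff all of them do. *)
Definition strong_spectral_decomposition (W : R -> R -> R) : Prop :=
  exists (lam gam : nat -> R) (phi psi : nat -> R -> R),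
    spectral_decomposition W lam gam phi psi /\
    \forall s \ae mu, unit_itv R s ->
      (\sum_(0 <= j <oo) (lam j * phi j s ^+ 2 + gam j * psi j s ^+ 2)%:E
         < +oo)%E.

End spectral.

Section square_summable.
Context {R : realType}.
Implicit Types x y : nat -> R.

Definition square_summable : {pred (nat -> R^o)} :=
  [pred x : nat -> R^o | `[< cvgn (series (fun j => (x j : R) ^+ 2)) >]].

Lemma square_summableP x :
  reflect (cvgn (series (fun j => x j ^+ 2))) (x \in square_summable).
Proof. exact: asboolP. Qed.

Lemma is_cvg_series_mul x y : x \in square_summable -> y \in square_summable ->
  cvgn (series (fun j => x j * y j)).
Proof.
move=> /square_summableP xs /square_summableP ys; apply: normed_cvg.
apply: (@series_le_cvg _ _ (fun j => x j ^+ 2 + y j ^+ 2)) => [j|j|j|].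
- exact: normr_ge0.
- by rewrite addr_ge0 ?sqr_ge0.
- by rewrite /= ler_norml; nra.
- exact: (is_cvg_seriesD xs ys).
Qed.

Lemma square_summable_submod_closed : submod_closed square_summable.
Proof.
split=> [|a x y xs ys].
  apply/square_summableP.
  suff -> : (fun j => (0 : nat -> R^o) j ^+ 2) = 0 :> (nat -> R).
    rewrite (_ : series 0 = cst 0); first exact: is_cvg_cst.
    by apply/funext => n; rewrite /series /= big1.
  by apply/funext => j; rewrite /= expr0n.
apply/square_summableP.
have xys := is_cvg_series_mul xs ys.
move: xs ys => /square_summableP xs /square_summableP ys.
suff -> : (fun j => (a *: x + y) j ^+ 2) =
    a ^+ 2 *: (fun j => x j ^+ 2) + (2 * a) *: (fun j => x j * y j) +
    (fun j => y j ^+ 2) :> (nat -> R).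
  by do 2![apply: is_cvg_seriesD => //]; apply: is_cvg_seriesZ.
by apply/funext => j; rewrite !fctE /GRing.scale /=; ring.
Qed.

HB.instance Definition _ := GRing.isSubmodClosed.Build R (nat -> R^o)
  square_summable square_summable_submod_closed.

End square_summable.

Definition ell2 (R : realType) : Type := {x : nat -> R^o | x \in square_summable}.

Section ell2.
Context {R : realType}.

HB.instance Definition _ := [isSub of ell2 R for @sval _ _].
HB.instance Definition _ := [Choice of ell2 R by <:].
HB.instance Definition _ := [SubChoice_isSubLmodule of ell2 R by <:].

Definition ell2_dot (x y : ell2 R) : R :=
  limn (series (fun j => (val x j : R) * val y j)).

Lemma is_cvg_ell2_dot (x y : ell2 R) :
  cvgn (series (fun j => (val x j : R) * val y j)).
Proof. by apply: is_cvg_series_mul; exact: valP. Qed.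

Lemma ell2_dotC (x y : ell2 R) : ell2_dot x y = ell2_dot y x.
Proof.
by congr (limn (series _)); apply/funext => j; rewrite mulrC.
Qed.

Lemma ell2_dotDZl a (x y z : ell2 R) :
  ell2_dot (a *: x + y) z = a * ell2_dot x z + ell2_dot y z.
Proof.
rewrite /ell2_dot.
have -> : (fun j => (val (a *: x + y) j : R) * val z j) =
    a *: (fun j => (val x j : R) * val z j) + (fun j => (val y j : R) * val z j)
    :> (nat -> R).
  apply/funext => j; rewrite (_ : val _ = a *: val x + val y) ?fctE //.
  by rewrite /GRing.scale /=; ring.
rewrite lim_seriesD; last exact: is_cvg_ell2_dot.
  by rewrite lim_seriesZ//; exact: is_cvg_ell2_dot.
by apply: is_cvg_seriesZ; exact: is_cvg_ell2_dot.
Qed.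

Lemma ell2_dot_ge (x : ell2 R) j : (val x j : R) ^+ 2 <= ell2_dot x x.
Proof.
have := @is_cvg_ell2_dot x x; set u := series _ => cu.
have u_nd : nondecreasing_seq u.
  by apply/nondecreasing_series => k _ _; rewrite -expr2 sqr_ge0.
apply: le_trans (nondecreasing_cvgn_le u_nd cu j.+1).
rewrite /u /series /= big_nat_recr //= -expr2 lerDr sumr_ge0 // => k _.
by rewrite -expr2 sqr_ge0.
Qed.

Lemma ell2_dot_ge0 (x : ell2 R) : 0 <= ell2_dot x x.
Proof. exact: le_trans (sqr_ge0 _) (ell2_dot_ge x 0). Qed.

Lemma ell2_dot_eq0 (x : ell2 R) : ell2_dot x x = 0 -> x = 0.
Proof.
move=> x0; apply/val_inj/funext => j /=.
have := ell2_dot_ge x j; rewrite x0 => xj0.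
by apply/eqP; rewrite -sqrf_eq0 eq_le xj0 sqr_ge0.
Qed.

End ell2.

Definition krein (R : realType) : Type := (ell2 R * ell2 R)%type.

Section krein.
Context {R : realType}.
Implicit Types z : krein R.

HB.instance Definition _ := GRing.Lmodule.copy (krein R) (ell2 R * ell2 R)%type.

Definition krein_dot z z' : R := ell2_dot z.1 z'.1 - ell2_dot z.2 z'.2.

Definition krein_norm z : R :=
  Num.sqrt (ell2_dot z.1 z.1 + ell2_dot z.2 z.2).

Let edot z z' : R := ell2_dot z.1 z'.1 + ell2_dot z.2 z'.2.

Let edotC z z' : edot z z' = edot z' z.
Proof. by rewrite /edot ell2_dotC (ell2_dotC z.2). Qed.

Let edotDZl a z z1 z' : edot (a *: z + z1) z' = a * edot z z' + edot z1 z'.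
Proof. by rewrite /edot /= !ell2_dotDZl; ring. Qed.

Let edotDZ a z z' :
  edot (a *: z + z') (a *: z + z') =
  a ^+ 2 * edot z z + 2 * a * edot z z' + edot z' z'.
Proof.
by rewrite edotDZl !(edotC _ (a *: z + z')) !edotDZl (edotC z' z); ring.
Qed.

Let edot_ge0 z : 0 <= edot z z.
Proof. by rewrite addr_ge0 ?ell2_dot_ge0. Qed.

Let edot_CS z z' : edot z z' ^+ 2 <= edot z z * edot z' z'.
Proof.
have [z0|z0] := eqVneq (edot z z) 0.
  rewrite z0 mul0r; have [->|zz'] := eqVneq (edot z z') 0; first by rewrite expr0n.
  have := edot_ge0 ((- (edot z' z' + 1) / (2 * edot z z')) *: z + z').
  rewrite edotDZ z0 mulr0 add0r.
  have -> : 2 * (- (edot z' z' + 1) / (2 * edot z z')) * edot z z' =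
    - (edot z' z' + 1) by field.
  by lra.
have zgt0 : 0 < edot z z by rewrite lt_neqAle eq_sym z0 edot_ge0.
have := edot_ge0 ((- edot z z' / edot z z) *: z + z').
rewrite edotDZ -(pmulr_rge0 _ zgt0) => h; rewrite -subr_ge0.
apply: (le_trans h).
by rewrite le_eqVlt; apply/orP; left; apply/eqP; field.
Qed.

Let krein_normE z : krein_norm z = Num.sqrt (edot z z).
Proof. by []. Qed.

Lemma ler_krein_normD z z' : krein_norm (z + z') <= krein_norm z + krein_norm z'.
Proof.
rewrite !krein_normE -(@ler_pXn2r _ 2%N) ?nnegrE ?addr_ge0 ?sqrtr_ge0 //.
rewrite sqrrD !sqr_sqrtr ?edot_ge0 // -[z in edot (z + _) _]scale1r.
rewrite -[z in edot _ (z + _)]scale1r edotDZ expr1n !mul1r mulr1.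
rewrite lerD2r lerD2l -[leRHS]mulr_natl ler_pM2l // -sqrtrM ?edot_ge0 //.
apply: le_trans (ler_norm _) _.
by rewrite -sqrtr_sqr ler_wsqrtr // edot_CS.
Qed.

Lemma krein_normZ (a : R) z : krein_norm (a *: z) = `|a| * krein_norm z.
Proof.
rewrite !krein_normE -sqrtr_sqr -sqrtrM ?sqr_ge0 //; congr Num.sqrt.
have edot0 z' : edot 0 z' = 0.
  by have := edotDZl (-1) z' z' z'; rewrite scaleN1r addNr => ->; ring.
by rewrite -[a *: z]addr0 edotDZ (edotC z) !edot0; ring.
Qed.

Lemma krein_norm_eq0 z : krein_norm z = 0 -> z = 0.
Proof.
case: z => x y; rewrite /krein_norm /= => /eqP; rewrite sqrtr_eq0 => xy0.
have x0 := ell2_dot_ge0 x; have y0 := ell2_dot_ge0 y.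
by congr pair; apply: ell2_dot_eq0; lra.
Qed.

HB.instance Definition _ := Lmodule_isNormed.Build R (krein R)
  ler_krein_normD krein_normZ krein_norm_eq0.

End krein.

Definition krein_borel (R : realType) :=
  g_sigma_algebraType (@open (krein R)).

Definition graph_root_distribution (R : realType)
    (F : probability (krein_borel R) R) : Prop :=
  (F \x F)%E [set z | 0 <= krein_dot z.1 z.2 <= 1] = 1%E.

(* [false]/[true] stand for the entries 0/1; the sigma-field is the product one,
   generated by the coordinates. *)
Definition array_cylinder : set (set (nat -> nat -> bool)) :=
  [set C | exists i j b, C = [set a | a i j = b]].

Definition array_measurableType := g_sigma_algebraType array_cylinder.

Section sampling.
Context {R : realType} {d d' : measure_display}.
Context {T : measurableType d} {S : measurableType d'}.
Context {P : probability T R}.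
Implicit Types (X : nat -> {RV P >-> S}) (A : {RV P >-> array_measurableType}).

Definition mutually_independent X : Prop :=
  forall (n : nat) (B : nat -> set S), (forall i, measurable (B i)) ->
    P [set t | forall i, (i < n)%N -> B i (X i t)] =
    (\prod_(i < n) P (X i @^-1` B i))%E.

Definition iid X (F : set S -> \bar R) : Prop :=
  mutually_independent X /\
  forall i (B : set S), measurable B -> distribution P (X i) B = F B.

Definition sigma_of X : set (set T) :=
  <<s \bigcup_i preimage_set_system setT (X i) measurable >>.

(* The last clause says that a version of the conditional probability of
   { A_ij = a_ij for i < j < n } given sigma(X_0, X_1, ...) is the product of
   the Bernoulli probabilities of the a_ij with parameters w(X_i, X_j). *)
Definition bernoulli_edges X (w : S -> S -> R) A : Prop :=
  [/\ forall t i j, A t j i = A t i j,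
      forall t i, A t i i = false &
      forall (n : nat) (a : nat -> nat -> bool) (E : set T), sigma_of X E ->
        P (E `&` [set t | forall i j, (i < j < n)%N -> A t i j = a i j]) =
        (\int[P]_(t in E)
           (\prod_(j < n) \prod_(i < j)
              bernoulli_pmf (w (X i t) (X j t)) (a i j))%:E)%E].

Definition has_law A (mu : probability array_measurableType R) : Prop :=
  forall E, measurable E -> distribution P A E = mu E.

End sampling.

Section array_laws.
Context {R : realType}.
Implicit Types mu : probability array_measurableType R.

Definition graphon_sampling_law (W : R -> R -> R) mu : Prop :=
  exists (d : measure_display) (T : measurableType d) (P : probability T R)
    (s : nat -> {RV P >-> R}) (A : {RV P >-> array_measurableType}),
    [/\ forall i t, unit_itv R (s i t),
        iid s (uniform_prob (@ltr01 R)), bernoulli_edges s W A & has_law A mu].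

Definition graph_root_sampling_law (F : probability (krein_borel R) R) mu :
    Prop :=
  exists (d : measure_display) (T : measurableType d) (P : probability T R)
    (Z : nat -> {RV P >-> krein_borel R}) (A : {RV P >-> array_measurableType}),
    [/\ iid Z F, bernoulli_edges Z krein_dot A & has_law A mu].

End array_laws.

(* Main.v *)
Require Import Defs.
From HB Require Import structures.
From mathcomp Require Import all_boot all_order all_algebra.
From mathcomp Require Import all_classical all_reals all_analysis.
From mathcomp Require Import measurable_realfun lra.
Set Implicit Arguments.
Unset Strict Implicit.
Unset Printing Implicit Defensive.
Import Order.TTheory GRing.Theory Num.Theory.
Import numFieldNormedType.Exports.

Local Open Scope classical_set_scope.
Local Open Scope ring_scope.

(** Send [s] in [[0, 1]] to the pair of sequences [sqrt lam_j * phi_j(s)] and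
    [sqrt gam_j * psi_j(s)], which are square summable for almost every [s] by
    strong spectral decomposition, and let [F] be the image of the uniform law
    under this map, which is measurable since the Krein space is separable. The
    partial expansions converge to the Krein inner product pointwise on almost
    all of the square and to [W] in L^2, so by Fatou's lemma [W] is almost
    everywhere the inner product of the images: [F] is a graph root
    distribution, and the images of the uniform sample of a graphon array are an
    iid sample of [F] with the same edge probabilities, almost surely. Finally
    the law of an array sampled with [F] is unique, because the probability of
    each finite pattern is an integral against the law of an iid sequence. *)

(** * Measurability in the Krein space *)

Section krein_measurability.
Context {R : realType}.

Definition ell2_coord (x : ell2 R) (j : nat) : R := val x j.

Lemma ell2_coordB (x y : ell2 R) j :
  ell2_coord (x - y) j = ell2_coord x j - ell2_coord y j.
Proof. by []. Qed.

Lemma ell2_dotE_cvg (x y : ell2 R) :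
  \sum_(0 <= j < n) ell2_coord x j * ell2_coord y j @[n --> \oo] -->
  ell2_dot x y.
Proof. exact: is_cvg_ell2_dot. Qed.

Lemma finite_support_square_summable (q : seq R) :
  (fun j => q`_j : R^o) \in @square_summable R.
Proof.
apply/square_summableP/cvg_ex; exists (series (fun j => q`_j ^+ 2) (size q)).
apply: cvg_near_cst; exists (size q) => // n /= qn.
rewrite /series /= (big_cat_nat (n := size q))//= [X in _ + X]big_nat_cond.
rewrite [X in _ + X]big1 ?addr0// => j /andP[/andP[qj _] _].
by rewrite nth_default// expr0n.
Qed.

(** Finite rational sequences padded with zeros: the countable dense set behind separability. *)
Definition ell2_rat (q : seq rat) : ell2 R :=
  exist (fun x : nat -> R^o => x \in square_summable) _
    (finite_support_square_summable (map ratr q)).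

Lemma ell2_rat_coord q j : ell2_coord (ell2_rat q) j = (map ratr q)`_j.
Proof. by []. Qed.

(** Cut [x] at a rank [N] where the tail of the squared norm is below [e / 3], and approximate the
    first [N] coordinates closely enough for their squared errors to add up to at most [e / 3]. *)
Lemma ell2_rat_dense (x : ell2 R) (e : R) : 0 < e ->
  exists q, ell2_dot (x - ell2_rat q) (x - ell2_rat q) < e.
Proof.
move=> e0.
have xx := @ell2_dotE_cvg x x.
pose s n : R := \sum_(0 <= j < n) ell2_coord x j * ell2_coord x j.
have s_nd : nondecreasing_seq s.
  by apply/nondecreasing_series => k _ _; rewrite -expr2 sqr_ge0.
have sle n : s n <= ell2_dot x x.
  rewrite -(cvg_lim _ xx)//.
  by apply: nondecreasing_cvgn_le; [exact: s_nd|exact: cvgP xx].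
have [N sN] : exists N, ell2_dot x x - s N < e / 3.
  have e3 : 0 < e / 3 by rewrite divr_gt0.
  move/cvgrPdist_lt : xx => /(_ _ e3)[N _ /(_ N (leqnn N))] /=.
  by move=> h; exists N; exact: le_lt_trans (ler_norm _) h.
(* [N] squared errors below [d ^+ 2] sum to at most [e / 3]; dividing by [N.+1] keeps [d] positive
   when [N = 0]. *)
pose d : R := Num.sqrt (e / 3 / N.+1%:R).
have d2 : 0 < e / 3 / N.+1%:R by rewrite !divr_gt0.
have d0 : 0 < d by rewrite sqrtr_gt0.
have /choice[r rP] : forall j, exists r : rat, `|ell2_coord x j - ratr r| < d.
  move=> j; have [r rj] :=
    @rat_in_itvoo R (ell2_coord x j - d) (ell2_coord x j + d) ltac:(lra).
  exists r; move: rj; rewrite in_itv/= ltr_norml => /andP[]; lra.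
exists (mkseq r N).
pose y : ell2 R := x - ell2_rat (mkseq r N); rewrite -/y.
have yE j : ell2_coord y j =
    if (j < N)%N then ell2_coord x j - ratr (r j) else ell2_coord x j.
  rewrite ell2_coordB ell2_rat_coord; case: ifPn => jN.
    by rewrite (nth_map 0) ?size_mkseq// nth_mkseq.
  by rewrite nth_default ?subr0// size_map size_mkseq leqNgt.
apply: (@le_lt_trans _ _ (e / 3 + e / 3)); last lra.
have yy := @ell2_dotE_cvg y y.
rewrite -(cvg_lim _ yy)//; apply: limr_le; first exact: cvgP yy.
exists N => // n /= Nn; rewrite (big_cat_nat (n := N))//=; apply: lerD.
  apply: (@le_trans _ _ (\sum_(0 <= j < N) (e / 3 / N.+1%:R))).
    apply: ler_sum_nat => j /andP[_ jN]; rewrite yE jN -expr2.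
    rewrite -real_normK ?num_real//.
    rewrite -[leRHS]sqr_sqrtr ?(ltW d2)// ler_sqr ?nnegrE ?sqrtr_ge0//.
    exact: ltW.
  rewrite sumr_const_nat subn0 -[_ *+ N]mulr_natr -mulrA.
  rewrite ler_piMr ?divr_ge0 ?(ltW e0)//.
  by rewrite mulrC ler_pdivrMr// mul1r ler_nat.
apply: (@le_trans _ _ (s n - s N)); last first.
  by apply: ltW; apply: le_lt_trans sN; rewrite lerD2r.
rewrite /s [X in _ <= X - _](big_cat_nat (n := N))//= addrAC subrr add0r.
apply: ler_sum_nat => j /andP[Nj _].
by rewrite yE ltnNge Nj.
Qed.

Lemma krein_normE (z : krein R) : `|z| = krein_norm z.
Proof. by []. Qed.

Lemma krein_rat_dense (z : krein R) (e : R) : 0 < e ->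
  exists q : seq rat * seq rat, `|z - (ell2_rat q.1, ell2_rat q.2)| < e.
Proof.
move=> e0; have e2 : 0 < e ^+ 2 / 2 by rewrite divr_gt0// exprn_gt0.
have [q1 h1] := ell2_rat_dense z.1 e2; have [q2 h2] := ell2_rat_dense z.2 e2.
exists (q1, q2); rewrite krein_normE /krein_norm -[ltRHS](gtr0_norm e0).
by rewrite -sqrtr_sqr ltr_sqrt ?exprn_gt0//=; lra.
Qed.

Lemma measurable_ell2_dot d (T : measurableType d) (f g : T -> ell2 R) :
  (forall j, measurable_fun setT (fun t => ell2_coord (f t) j)) ->
  (forall j, measurable_fun setT (fun t => ell2_coord (g t) j)) ->
  measurable_fun setT (fun t => ell2_dot (f t) (g t)).
Proof.
move=> mf mg.
pose h n t : R := \sum_(0 <= j < n) ell2_coord (f t) j * ell2_coord (g t) j.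
apply: (@measurable_fun_cvg _ _ _ _ h) => [n|t _]; last exact: ell2_dotE_cvg.
by rewrite /h; apply: measurable_sum => j; exact: measurable_funM.
Qed.

(** By separability an open set is a countable union of balls with rational centres and radii
    [n.+1%:R^-1]. The preimage of such a ball is measurable, as the squared distance to a fixed
    centre is a limit of polynomials in the coordinates. *)
Lemma measurable_krein d (T : measurableType d) (f : T -> krein R) :
  (forall j, measurable_fun setT (fun t => ell2_coord (f t).1 j)) ->
  (forall j, measurable_fun setT (fun t => ell2_coord (f t).2 j)) ->
  measurable_fun setT (f : T -> krein_borel R).
Proof.
move=> mf1 mf2.
apply: (@measurability _ _ T (krein_borel R) setT f (@open (krein R))) => //.
move=> _ [U oU <-]; rewrite setTI.
(* Balls not contained in [U] are replaced by [set0], so that the union runs over a whole countable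
   type. *)
pose B (i : seq rat * seq rat * nat) : set T :=
  let c : krein R := (ell2_rat i.1.1, ell2_rat i.1.2) in
  if `[< ball c i.2.+1%:R^-1 `<=` U >] then [set t | `|f t - c| < i.2.+1%:R^-1]
  else set0.
have -> : f @^-1` U = \bigcup_i B i.
  apply/seteqP; split=> [t /= Uft|t [[[q1 q2] n] _]]; last first.
    rewrite /B/=; case: ifPn => // /asboolP + ftc; apply.
    by rewrite -ball_normE /= distrC.
  have /nbhs_ballP[e /= e0 eU] := open_nbhs_nbhs (conj oU Uft).
  (* Half of [e] pays for the distance from [f t] to the rational centre, the other half for the
     radius of the ball. *)
  have [n ne] : exists n, n.+1%:R^-1 < e / 2.
    have e2 : 0 < e / 2 by rewrite divr_gt0.
    have [n _ /(_ n (leqnn n))] := near_infty_natSinv_lt (PosNum e2).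
    by exists n.
  have n0 : 0 < n.+1%:R^-1 :> R by rewrite invr_gt0.
  have [[q1 q2] /= qn] := krein_rat_dense (f t) n0.
  exists (q1, q2, n) => //; rewrite /B/= asboolT// => z.
  rewrite -ball_normE /= => cz; apply: eU; rewrite -ball_normE /=.
  rewrite -(subrK ((ell2_rat q1, ell2_rat q2) : krein R) (f t)) -addrA.
  apply: le_lt_trans (ler_normD _ _) _; rewrite [ltRHS]splitr.
  by apply: ltrD; [exact: lt_trans qn ne|exact: lt_trans cz ne].
apply: countable_bigcupT_measurable => // -[[q1 q2] n].
rewrite /B/=; case: ifPn => // _.
set c : krein R := (_, _).
pose g t : R :=
  ell2_dot (f t - c).1 (f t - c).1 + ell2_dot (f t - c).2 (f t - c).2.
have mg : measurable_fun setT g.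
  by apply: measurable_funD; apply: measurable_ell2_dot => j /=;
     apply: measurable_funB.
have gE t : (`|f t - c| < n.+1%:R^-1) = (g t < n.+1%:R^-1 ^+ 2).
  have r0 : 0 < n.+1%:R^-1 :> R by rewrite invr_gt0.
  rewrite krein_normE /krein_norm -/(g t) -[in LHS](gtr0_norm r0) -sqrtr_sqr.
  by rewrite ltr_sqrt// exprn_gt0.
rewrite (_ : [set t | _] = g @^-1` `]-oo, n.+1%:R^-1 ^+ 2[%classic).
  by rewrite -[X in measurable X]setTI; exact: mg.
by apply/seteqP; split=> t /=; rewrite in_itv/= gE.
Qed.

Lemma ler_ell2_coord (x : ell2 R) j : ell2_coord x j ^+ 2 <= ell2_dot x x.
Proof. exact: ell2_dot_ge. Qed.

(** The sets where [f < x] are open, and the rays []-oo, x[] generate the Borel sets of the line.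
    This applies to the coordinates, each dominated by the norm. *)
Lemma measurable_krein_1Lipschitz (f : krein_borel R -> R) :
  (forall z w : krein R, `|f z - f w| <= `|z - w|) -> measurable_fun setT f.
Proof.
move=> fL; apply: (measurability _ (RGenInftyO.measurableE R)) => //.
move=> _ [_ [x ->] <-]; rewrite setTI; apply: sub_sigma_algebra.
rewrite openE => z /=; rewrite in_itv/= => fzx; apply/nbhs_ballP.
exists (x - f z) => /=; first by rewrite subr_gt0.
move=> w; rewrite -ball_normE /= in_itv/= => zw.
by have := le_lt_trans (fL z w) zw; rewrite ltr_norml => /andP[]; lra.
Qed.

Lemma measurable_krein_coord1 j :
  measurable_fun setT (fun z : krein_borel R => ell2_coord (z : krein R).1 j).
Proof.
apply: measurable_krein_1Lipschitz => z w; rewrite -ell2_coordB.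
rewrite -sqrtr_sqr krein_normE ler_wsqrtr//.
by apply: le_trans (ler_ell2_coord _ _) _; rewrite lerDl ell2_dot_ge0.
Qed.

Lemma measurable_krein_coord2 j :
  measurable_fun setT (fun z : krein_borel R => ell2_coord (z : krein R).2 j).
Proof.
apply: measurable_krein_1Lipschitz => z w; rewrite -ell2_coordB.
rewrite -sqrtr_sqr krein_normE ler_wsqrtr//.
by apply: le_trans (ler_ell2_coord _ _) _; rewrite lerDr ell2_dot_ge0.
Qed.

Lemma measurable_krein_dot d (T : measurableType d) (f g : T -> krein_borel R) :
  measurable_fun setT f -> measurable_fun setT g ->
  measurable_fun setT (fun t => krein_dot (f t) (g t)).
Proof.
move=> mf mg; apply: measurable_funB; apply: measurable_ell2_dot => j.
- exact: (measurableT_comp (measurable_krein_coord1 j) mf).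
- exact: (measurableT_comp (measurable_krein_coord1 j) mg).
- exact: (measurableT_comp (measurable_krein_coord2 j) mf).
- exact: (measurableT_comp (measurable_krein_coord2 j) mg).
Qed.

End krein_measurability.

(** * The root map of a graphon *)

Section square_summable_family.
Context {R : realType}.

(** Turns square summability into finiteness of an extended real sum, which depends measurably on
    parameters. *)
Lemma square_summableE (x : nat -> R^o) : (x \in square_summable) =
  (\sum_(0 <= j <oo) ((x j : R) ^+ 2)%:E < +oo)%E.
Proof.
apply/square_summableP/idP => [cx|]; last first.
  by apply: nnseries_is_cvg => j; exact: sqr_ge0.
rewrite (_ : (\sum_(_ <= _ <oo) _)%E =
  (limn (series (fun j => (x j : R) ^+ 2)))%:E).
  by rewrite ltry.
apply/cvg_lim => //; under eq_cvg do rewrite sumEFin.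
by apply: cvg_EFin; [near=> n|].
Unshelve. all: by end_near. Qed.

(* [0] when [x] is not square summable. *)
Definition ell2_of (x : nat -> R) : ell2 R :=
  insubd (0 : ell2 R) (x : nat -> R^o).

Lemma ell2_ofE (x : nat -> R) j : (x : nat -> R^o) \in square_summable ->
  ell2_coord (ell2_of x) j = x j.
Proof. by move=> xs; rewrite /ell2_coord /ell2_of insubdK. Qed.

(** The choice between [c j t] and the default 0 is made by the measurable event that the sum of
    squares is finite. *)
Lemma measurable_ell2_of d (T : measurableType d) (c : nat -> T -> R) j :
  (forall j, measurable_fun setT (c j)) ->
  measurable_fun setT (fun t => ell2_coord (ell2_of (c ^~ t)) j).
Proof.
move=> mc; pose S t : \bar R := (\sum_(0 <= j <oo) ((c j t) ^+ 2)%:E)%E.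
have mS : measurable_fun setT S.
  apply: ge0_emeasurable_sum => [k t _ _|k _]; first by rewrite lee_fin sqr_ge0.
  by apply/measurable_EFinP/measurable_funX.
rewrite (_ : (fun t => _) = fun t => if (S t < +oo)%E then c j t else 0).
  apply: measurable_fun_ifT => //.
  by apply: (measurable_fun_lte mS); exact: measurable_cst.
apply/funext => t.
rewrite /ell2_coord /ell2_of val_insubd square_summableE -/(S t).
by case: ifP.
Qed.

End square_summable_family.

Lemma uniform_probE (R : realType) (A : set R) : measurable A ->
  uniform_prob (@ltr01 R) A = lebesgue_measure (A `&` unit_itv R).
Proof.
move=> mA; have mAI : measurable (A `&` unit_itv R).
  by apply: measurableI => //; exact: measurable_itv.
rewrite /uniform_prob integral_uniform_pdf.
rewrite (eq_integral (cst 1%E)); first by rewrite integral_cst// mul1e.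
move=> x; rewrite inE/= in_itv/= /uniform_pdf => -[_ ->].
by rewrite subr0 invr1.
Qed.

(** By uniqueness of the product measure, it suffices to compare both sides on rectangles. *)
Lemma uniform_prob2E (R : realType) (X : set (R * R)) : measurable X ->
  (uniform_prob (@ltr01 R) \x uniform_prob (@ltr01 R))%E X =
  (lebesgue_measure \x lebesgue_measure)%E (X `&` unit_itv R `*` unit_itv R).
Proof.
have mII : measurable (unit_itv R `*` unit_itv R).
  by apply: measurableX; exact: measurable_itv.
move=> mX; pose m := mrestr (@lebesgue_measure R \x @lebesgue_measure R)%E mII.
apply: (@product_measure_unique _ _ _ _ R _ _ m) => // A B mA mB.
rewrite /m /= /mrestr !uniform_probE// -setXI product_measure1E//.
all: by apply: measurableI => //; exact: measurable_itv.
Qed.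

Section graphon_root.
Context {R : realType}.
Local Notation mu := (@lebesgue_measure R).
Local Notation I := (unit_itv R).
Variables (W : R -> R -> R) (lam gam : nat -> R) (phi psi : nat -> R -> R).
Hypothesis gW : graphon W.
Hypothesis dW : spectral_decomposition W lam gam phi psi.
Hypothesis sW : \forall s \ae mu, unit_itv R s ->
  (\sum_(0 <= j <oo) (lam j * phi j s ^+ 2 + gam j * psi j s ^+ 2)%:E < +oo)%E.

(* When [l j = 0], [c l f j] vanishes, so it is measurable although [f j] is
   then unconstrained. *)
Let c l (f : nat -> R -> R) j := (fun s => Num.sqrt (l j) * f j s) \_ I.

Let measurable_c (l : nat -> R) f j : 0 <= l j ->
  (0 < l j -> measurable_fun I (f j)) -> measurable_fun setT (c l f j).
Proof.
rewrite le_eqVlt => /predU1P[l0 _|l0 /(_ l0) mf].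
  rewrite (_ : c l f j = cst 0); first exact: measurable_cst.
  by apply/funext => s; rewrite /c patchE -l0 sqrtr0 mul0r if_same.
apply: (measurable_restrictT _ (measurable_itv `[0, 1])).1.
by apply: measurable_funM => //; exact: measurable_cst.
Qed.

Let measurable_c_phi j : measurable_fun setT (c lam phi j).
Proof.
apply: measurable_c; first exact: (lam_ge0 dW).
by move=> /(phi_eigen dW)[[]].
Qed.

Let measurable_c_psi j : measurable_fun setT (c gam psi j).
Proof.
apply: measurable_c; first exact: (gam_ge0 dW).
by move=> /(psi_eigen dW)[[]].
Qed.

(** Total in [s]: coordinates vanish off the unit interval, and a component that is not square
    summable is replaced by 0. *)
Definition krein_root (s : R) : krein_borel R :=
  (ell2_of (c lam phi ^~ s), ell2_of (c gam psi ^~ s)).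

Lemma measurable_krein_root : measurable_fun setT krein_root.
Proof. by apply: measurable_krein => j; exact: measurable_ell2_of. Qed.

(** The good points: there no default value is used, and the coordinates of [krein_root] are the
    intended ones. *)
Let G : set R := I `&` [set s |
  ((c lam phi ^~ s : nat -> R^o) \in square_summable) &&
  ((c gam psi ^~ s : nat -> R^o) \in square_summable)].

Let measurable_G : measurable G.
Proof.
apply: measurableI; first exact: measurable_itv.
rewrite (_ : [set s | _] =
  [set s | (\sum_(0 <= j <oo) ((c lam phi j s) ^+ 2)%:E < +oo)%E] `&`
  [set s | (\sum_(0 <= j <oo) ((c gam psi j s) ^+ 2)%:E < +oo)%E]); last first.
  by apply/seteqP; split=> s /=; rewrite !square_summableE => /andP.
by apply: measurableI; rewrite -[X in measurable X]setTI;
  apply: emeasurable_fun_infty_o => //;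
  apply: ge0_emeasurable_sum => [k t _ _|k _];
  rewrite ?lee_fin ?sqr_ge0//; apply/measurable_EFinP/measurable_funX.
Qed.

(** Each of the two sums of squares is dominated by the sum that strong spectral decomposition makes
    finite almost everywhere. *)
Let negligible_G : mu (I `\` G) = 0%E.
Proof.
have mIG : measurable (I `\` G).
  by apply: measurableD => //; exact: measurable_itv.
apply: (@measure_negligible _ _ _ mu _ mIG).
apply: negligibleS sW => s [Is nGs] /= /(_ Is) h; apply: nGs; split => //=.
have cE l f j : 0 <= l j -> c l f j s ^+ 2 = l j * f j s ^+ 2.
  by move=> l0; rewrite /c patchE mem_set// exprMn sqr_sqrtr.
have l0 j := lam_ge0 dW j; have g0 j := gam_ge0 dW j.
by rewrite !square_summableE; apply/andP; split; apply: le_lt_trans h;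
  apply: lee_nneseries => j _; rewrite ?lee_fin ?sqr_ge0// cE// ?lerDl ?lerDr//;
  rewrite mulr_ge0 ?sqr_ge0.
Qed.

Let partial_expansionE n s s' : I s -> I s' ->
  partial_expansion lam gam phi psi n s s' =
  \sum_(0 <= j < n) c lam phi j s * c lam phi j s' -
  \sum_(0 <= j < n) c gam psi j s * c gam psi j s'.
Proof.
move=> Is Is'.
have cE l f j : 0 <= l j -> l j * f j s * f j s' = c l f j s * c l f j s'.
  by move=> l0; rewrite /c !patchE !mem_set// mulrACA -expr2 sqr_sqrtr// mulrA.
congr (_ - _); apply: eq_bigr => j _; apply: cE.
  exact: (lam_ge0 dW).
exact: (gam_ge0 dW).
Qed.

Let cvg_partial_expansion s s' : G s -> G s' ->
  partial_expansion lam gam phi psi n s s' @[n --> \oo] -->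
  krein_dot (krein_root s) (krein_root s').
Proof.
move=> [Is /andP[s1 s2]] [Is' /andP[s1' s2']].
under eq_cvg => n.
  rewrite partial_expansionE//.
  under eq_bigr do rewrite -(ell2_ofE _ s1) -(ell2_ofE _ s1').
  under [X in _ - X]eq_bigr do rewrite -(ell2_ofE _ s2) -(ell2_ofE _ s2').
  over.
by apply: cvgB; exact: ell2_dotE_cvg.
Qed.

(** On [G * G] the squared errors [f n] tend pointwise to [g]. By Fatou's lemma the integral of [g]
    is at most the limit of the L2 errors, which is 0, so the nonnegative [g] vanishes almost
    everywhere. *)
Let graphon_root_ae_cvg : \forall z \ae (mu \x mu)%E, (G `*` G) z ->
  W z.1 z.2 = krein_dot (krein_root z.1) (krein_root z.2).
Proof.
have mII : measurable (I `*` I) by apply: measurableX; exact: measurable_itv.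
have mGG : measurable (G `*` G) by apply: measurableX.
have GGII : G `*` G `<=` I `*` I by move=> z [[? _] [? _]].
have mW : measurable_fun (I `*` I) (fun z : R * R => W z.1 z.2) by case: gW.
pose f n (z : R * R) : R :=
  (W z.1 z.2 - partial_expansion lam gam phi psi n z.1 z.2) ^+ 2.
pose g (z : R * R) : R :=
  (W z.1 z.2 - krein_dot (krein_root z.1) (krein_root z.2)) ^+ 2.
have mg : measurable_fun (G `*` G) g.
  apply: measurable_funX; apply: measurable_funB.
    exact: measurable_funS mW.
  apply: measurable_funTS; apply: measurable_krein_dot.
    exact: (measurableT_comp measurable_krein_root measurable_fst).
  exact: (measurableT_comp measurable_krein_root measurable_snd).
have mf n : measurable_fun (I `*` I) (EFin \o f n).
  apply/measurable_EFinP; apply: measurable_funX; apply: measurable_funB => //.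
  (* The functions [phi j] and [psi j] need not be measurable when their eigenvalue is 0, whereas
     the [c] always are. *)
  apply: (@eq_measurable_fun _ _ _ _ _ (fun z : R * R =>
    \sum_(0 <= j < n) c lam phi j z.1 * c lam phi j z.2 -
    \sum_(0 <= j < n) c gam psi j z.1 * c gam psi j z.2)).
    by move=> z; rewrite inE => -[z1 z2]; rewrite partial_expansionE.
  apply: measurable_funTS.
  by apply: measurable_funB; apply: measurable_sum => j; apply: measurable_funM;
    apply: measurableT_comp.
have fg z : (G `*` G) z -> (f n z)%:E @[n --> \oo] --> (g z)%:E.
  move=> [/= z1 z2]; have : f n z @[n --> \oo] --> g z.
    by apply: cvgM;
      (apply: cvgB; [exact: cvg_cst|exact: cvg_partial_expansion]).
  by move=> fgz; apply: cvg_EFin; [near=> n|].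
have g0 : (\int[mu \x mu]_(z in G `*` G) `|(g z)%:E|)%E = 0%E.
  apply/eqP; rewrite eq_le integral_ge0 ?andbT; last first.
    by move=> z _; exact: abse_ge0.
  under eq_integral => z zGG.
    rewrite gee0_abs ?lee_fin ?sqr_ge0//.
    (* [g] is written as a lower limit, the form in which Fatou's lemma applies. *)
    rewrite -(cvg_limn_einf_sup (fg z _)).1; last first.
      by rewrite inE in zGG.
    over.
  have fatou_f := @fatou _ _ R (mu \x mu)%E _ mGG (fun n => EFin \o f n).
  apply: le_trans (fatou_f _ _) _.
  - by move=> n; exact: measurable_funS (mf n).
  - by move=> n z _; rewrite lee_fin sqr_ge0.
  rewrite (cvg_limn_einf_sup (_ : _ --> 0%E)).1//.
  apply: (squeeze_cvge _ (cvg_cst 0%E) (expansion_cvg dW)).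
  apply: nearW => n; apply/andP; split.
    by apply: integral_ge0 => z _; rewrite lee_fin sqr_ge0.
  apply: (@ge0_subset_integral _ _ R (mu \x mu)%E _ _ mGG mII _ (mf n)) => //.
  by move=> z _; rewrite lee_fin sqr_ge0.
have mEg : measurable_fun (G `*` G) (EFin \o g) by exact/measurable_EFinP.
have [/(_ g0) + _] := @ae_eq_integral_abs _ _ R (mu \x mu)%E _ mGG _ mEg.
apply: filterS => z /[apply] /= -[/eqP]; rewrite sqrf_eq0 subr_eq0 => /eqP //.
Unshelve. all: by end_near. Qed.

(** [N] covers the exceptional pairs of [G * G] and the two null strips where one point lies outside
    [G]. It is made measurable so that it can be pulled back along pairs of sample points. *)
Lemma graphon_root_ae : exists N : set (R * R),
  [/\ measurable N,
      (uniform_prob (@ltr01 R) \x uniform_prob (@ltr01 R))%E N = 0%E &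
      forall s s', I s -> I s' -> ~ N (s, s') ->
        W s s' = krein_dot (krein_root s) (krein_root s')].
Proof.
have mI : measurable I by exact: measurable_itv.
have mIG : measurable (I `\` G) by exact: measurableD.
have nl : (mu \x mu)%E.-negligible ((I `\` G) `*` I).
  apply/negligibleP; first exact: measurableX.
  apply: etrans (product_measure1E mu mu mIG mI) _.
  by rewrite /= negligible_G mul0e.
have nr : (mu \x mu)%E.-negligible (I `*` (I `\` G)).
  apply/negligibleP; first exact: measurableX.
  apply: etrans (product_measure1E mu mu mI mIG) _.
  by rewrite /= negligible_G mule0.
have [N [mN N0 sN]] := negligibleU graphon_root_ae_cvg (negligibleU nl nr).
exists N; split => // [|s s' Is Is' nN].
  rewrite uniform_prob2E//; apply/eqP; rewrite eq_le measure_ge0 andbT -N0.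
  apply: le_measure; rewrite ?inE//.
  by apply: measurableI => //; exact: measurableX.
have {}nN := contra_not (sN (s, s')) nN.
apply: contrapT => Wk; apply: nN.
have [Gs|nGs] := pselect (G s); last by right; left.
have [Gs'|nGs'] := pselect (G s'); last by right; right.
by left => /(_ (conj Gs Gs')).
Qed.

End graphon_root.

(** * Laws of iid samples *)

Section mfun_of.
Context d d' (T : measurableType d) (S : measurableType d').

Definition mfun_of (f : T -> S) (mf : measurable_fun setT f) :
  {mfun T >-> S} :=
  HB.pack_for {mfun T >-> S} f (isMeasurableFun.Build _ _ _ _ f mf).

End mfun_of.

Section iid.
Context {R : realType} {d d' : measure_display}.
Context {T : measurableType d} {S : measurableType d'}.
Context {P : probability T R}.
Implicit Types (X : nat -> {RV P >-> S}) (F : probability S R).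

(** By uniqueness of the product measure only rectangles matter, and for these independence of the
    first [(maxn i j).+1] variables gives the product. *)
Lemma iid_pair_law X F i j (C : set (S * S)) :
  iid X F -> i != j -> measurable C ->
  P [set t | C (X i t, X j t)] = (F \x F)%E C.
Proof.
move=> [indX lawX] ij mC.
have mX : measurable_fun setT (fun t => (X i t, X j t)).
  by apply: measurable_fun_pair.
pose m := distribution P (mfun_of mX).
rewrite (@product_measure_unique _ _ _ _ R F F m)// => A B mA mB.
(* The other indices get [setT], which contributes a factor 1. *)
pose D k := if k == i then A else if k == j then B else setT.
have mD k : measurable (D k) by rewrite /D; case: ifP => // _; case: ifP.
have iN : (i < (maxn i j).+1)%N by rewrite ltnS leq_maxl.
have jN : (j < (maxn i j).+1)%N by rewrite ltnS leq_maxr.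
transitivity (P [set t | forall k, (k < (maxn i j).+1)%N -> D k (X k t)]).
  congr (P _); apply/seteqP; split=> t /=.
    move=> [At Bt] k _; rewrite /D; case: eqP => [->//|_].
    by case: eqP => [->|].
  move=> h; split; first by have := h i iN; rewrite /D eqxx.
  by have := h j jN; rewrite /D eqxx eq_sym (negbTE ij).
rewrite indX// (bigD1 (Ordinal iN))//= (bigD1 (Ordinal jN))/=; last first.
  by rewrite -val_eqE/= eq_sym.
rewrite /D eqxx eqxx eq_sym (negbTE ij) big1 => [|k /andP[ki kj]].
  by rewrite mule1 -(lawX i)// -(lawX j).
by rewrite !ifN// preimage_setT probability_setT.
Qed.

End iid.

(** * The law of an iid sequence *)

Section sequence_law.
Context {d' : measure_display} {S : measurableType d'}.

(** Finite-dimensional boxes: exactly the events of [mutually_independent], and a pi-system. *)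
Definition seq_cylinder : set (set (nat -> S)) :=
  [set C | exists n (B : nat -> set S), (forall i, measurable (B i)) /\
    C = [set x | forall i, (i < n)%N -> B i (x i)]].

Definition sequence_measurableType := g_sigma_algebraType seq_cylinder.

Lemma seq_cylinderI : setI_closed seq_cylinder.
Proof.
move=> _ _ [n [B [mB ->]]] [m [C [mC ->]]].
pose D i :=
  (if (i < n)%N then B i else setT) `&` (if (i < m)%N then C i else setT).
exists (maxn n m), D; split.
  by move=> i; apply: measurableI; case: ifP.
apply/seteqP; split=> x /=.
  by move=> [Bx Cx] i _; split; case: ifPn => //; [exact: Bx|exact: Cx].
move=> h; split=> i ni; have := h i; rewrite /D /= leq_max ni ?orbT.
  by move=> /(_ erefl)[].
by move=> /(_ erefl)[].
Qed.

Lemma measurable_seq_coord i :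
  measurable_fun setT (fun x : sequence_measurableType => x i).
Proof.
move=> _ B mB; rewrite setTI; apply: sub_sigma_algebra.
exists i.+1, (fun k => if k == i then B else setT); split.
  by move=> k; case: ifP.
apply/seteqP; split=> x /=.
  by move=> Bx k _; case: eqP => [->|].
by move=> /(_ i (ltnSn i)); rewrite eqxx.
Qed.

Lemma measurable_to_sequence d (T : measurableType d) (f : nat -> T -> S) :
  (forall i, measurable_fun setT (f i)) ->
  measurable_fun setT ((fun t i => f i t) : T -> sequence_measurableType).
Proof.
move=> mf.
apply: (@measurability _ _ T sequence_measurableType setT _ seq_cylinder) => //.
move=> _ [_ [n [B [mB ->]]] <-]; rewrite setTI.
rewrite (_ : _ @^-1` _ = \bigcap_i (if (i < n)%N then f i @^-1` B i else setT)).
  apply: bigcapT_measurable => i; case: ifP => // _.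
  by rewrite -[X in measurable X]setTI; exact: mf.
apply/seteqP; split=> t /=.
  by move=> h i _; case: ifPn => // /h.
by move=> h i ni; have := h i I; rewrite ni.
Qed.

(** Both sequences give a box the same product of [F]-probabilities, so their laws agree on the
    generated sigma-field, and so do integrals against them. *)
Lemma iid_integral (R : realType) (F : probability S R)
    d1 (T1 : measurableType d1) (P1 : probability T1 R)
    d2 (T2 : measurableType d2) (P2 : probability T2 R)
    (X1 : nat -> {RV P1 >-> S}) (X2 : nat -> {RV P2 >-> S})
    (f : sequence_measurableType -> \bar R) :
  iid X1 F -> iid X2 F -> measurable_fun setT f ->
  (\int[P1]_t f (fun i => X1 i t) = \int[P2]_t f (fun i => X2 i t))%E.
Proof.
move=> [ind1 law1] [ind2 law2] mf.
have m1 := measurable_to_sequence (fun i => @measurable_funPT _ _ _ _ (X1 i)).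
have m2 := measurable_to_sequence (fun i => @measurable_funPT _ _ _ _ (X2 i)).
pose Q1 := distribution P1 (mfun_of m1).
pose Q2 := distribution P2 (mfun_of m2).
have Q12 A : measurable A -> Q1 A = Q2 A.
  apply: (@measure_unique _ R sequence_measurableType seq_cylinder
    (fun=> setT) _ _ _ _ Q1 Q2) => //.
  - exact: seq_cylinderI.
  - by move=> _; exists 0%N, (fun=> setT); split => //; apply/seteqP; split.
  - by rewrite bigcup_const//; exists 0%N.
  - move=> _ [n [B [mB ->]]].
    rewrite [LHS](ind1 n B mB) [RHS](ind2 n B mB); apply: eq_bigr => i _.
    by rewrite -[LHS]/(distribution P1 (X1 i) _) law1// -(law2 i).
  - by move=> _; rewrite (le_lt_trans (probability_le1 _ _))// ltry.
(* Change of variables is applied to nonnegative functions first, then to the positive and negative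
   parts of [f]. *)
have eqg (g : sequence_measurableType -> \bar R) : measurable_fun setT g ->
    (forall x, 0 <= g x)%E ->
    (\int[P1]_t g (fun i => X1 i t) = \int[P2]_t g (fun i => X2 i t))%E.
  move=> mg g0.
  rewrite -[LHS](ge0_integral_distribution (mfun_of m1))//.
  rewrite -[RHS](ge0_integral_distribution (mfun_of m2))//.
  by apply: eq_measure_integral => A mA _; exact: Q12.
have fp := eqg f^\+%E (measurable_funepos mf) (funepos_ge0 f).
have fn := eqg f^\-%E (measurable_funeneg mf) (funeneg_ge0 f).
rewrite integralE [RHS]integralE; congr (_ - _)%E.
  (* Unfolding and refolding turns the positive part of a composite into the composite with the
     positive part. *)
  by under eq_integral do rewrite funeposE -funeposE;
    under [RHS]eq_integral do rewrite funeposE -funeposE.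
by under eq_integral do rewrite funenegE -funenegE;
  under [RHS]eq_integral do rewrite funenegE -funenegE.
Qed.

End sequence_law.

(** * Laws of sampled arrays *)

Section edges.
Context {R : realType}.

Lemma measurable_bernoulli_pmf d (T : measurableType d) (p : T -> R) b :
  measurable_fun setT p -> measurable_fun setT (fun t => bernoulli_pmf (p t) b).
Proof.
move=> mp; case: b => //=.
by apply: measurable_funB => //; exact: measurable_cst.
Qed.

Lemma measurable_edges_likelihood d (T : measurableType d) n
    (p : nat -> nat -> T -> R) (a : nat -> nat -> bool) :
  (forall i j, measurable_fun setT (p i j)) ->
  measurable_fun setT (fun t =>
    (\prod_(j < n) \prod_(i < j) bernoulli_pmf (p i j t) (a i j))%:E).
Proof.
move=> mp; apply/measurable_EFinP; apply: measurable_prod => j _.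
apply: measurable_prod => i _; exact: measurable_bernoulli_pmf.
Qed.

Lemma sigma_of_measurable d d' (T : measurableType d) (S : measurableType d')
    (P : probability T R) (X : nat -> {RV P >-> S}) :
  sigma_of X `<=` measurable.
Proof.
apply: smallest_sub; first exact: sigma_algebra_measurable.
move=> _ [i _ [B mB <-]]; rewrite setTI -[X in measurable X]setTI.
exact: measurable_funPT.
Qed.

(** * Relabelling the vertices of a sampled array by a map *)

Section transfer.
Context {d d1 d2 : measure_display} {T : measurableType d}.
Context {S1 : measurableType d1} {S2 : measurableType d2} {P : probability T R}.
Variables (F : probability S1 R) (X : nat -> {RV P >-> S1}).
Variables (g : S1 -> S2) (mg : measurable_fun setT g).

Definition rv_map i : {RV P >-> S2} :=
  mfun_of (measurableT_comp mg (@measurable_funPT _ _ _ _ (X i))).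

Lemma iid_rv_map : iid X F -> iid rv_map (distribution F (mfun_of mg)).
Proof.
move=> [indX lawX].
have mgB B : measurable B -> measurable (g @^-1` B).
  by move=> mB; rewrite -[X in measurable X]setTI; exact: mg.
split=> [n B mB|i B mB]; last exact: lawX (mgB _ mB).
by rewrite [LHS](indX n (fun i => g @^-1` B i))// => i; exact: mgB.
Qed.

Lemma sigma_of_rv_map : sigma_of rv_map `<=` sigma_of X.
Proof.
apply: smallest_sub; first exact: smallest_sigma_algebra.
move=> _ [i _ [B mB <-]]; apply: sub_sigma_algebra; exists i => //.
exists (g @^-1` B); first by rewrite -[X in measurable X]setTI; exact: mg.
by [].
Qed.

(** The images generate a smaller sigma-field, so the edge formula for [X] covers all their
    conditioning events. The two likelihoods differ only when some pair of distinct indices falls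
    into [N], a countable union of null events by [iid_pair_law]. *)
Lemma bernoulli_edges_rv_map (w1 : S1 -> S1 -> R) (w2 : S2 -> S2 -> R)
    (A : {RV P >-> array_measurableType}) (N : set (S1 * S1)) :
  iid X F -> measurable N -> (F \x F)%E N = 0%E ->
  (forall t i j, ~ N (X i t, X j t) ->
    w1 (X i t) (X j t) = w2 (g (X i t)) (g (X j t))) ->
  (forall i j, measurable_fun setT (fun t => w1 (X i t) (X j t))) ->
  (forall i j, measurable_fun setT (fun t => w2 (g (X i t)) (g (X j t)))) ->
  bernoulli_edges X w1 A -> bernoulli_edges rv_map w2 A.
Proof.
move=> iidX mN N0 w12 mw1 mw2 [symA diagA law]; split => // n a E sE.
have sXE := sigma_of_rv_map sE; have mE := sigma_of_measurable sXE.
rewrite law//; apply: ae_eq_integral => //.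
- exact: (measurable_funTS (measurable_edges_likelihood n a mw1)).
- exact: (measurable_funTS (measurable_edges_likelihood n a mw2)).
(* The diagonal must be left out: [N] is null for the product law, yet may contain [(X i t, X i t)]
   for every [t]. *)
pose M i j := if i == j then set0 else [set t | N (X i t, X j t)].
have nM : P.-negligible (\bigcup_i \bigcup_j M i j).
  apply: negligible_bigcup => i; apply: negligible_bigcup => j.
  rewrite /M; case: eqVneq => [_|ij]; first exact: negligible_set0.
  apply/negligibleP; last exact: etrans (iid_pair_law iidX ij mN) N0.
  have mXX : measurable_fun setT (fun t => (X i t, X j t)).
    by apply: measurable_fun_pair.
  by have := mXX measurableT _ mN; rewrite setTI.
apply: negligibleS nM => t /= nt; apply: contrapT => nMt; apply: nt => _ /=.
congr EFin; apply: eq_bigr => j _; apply: eq_bigr => i _.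
rewrite w12// => Nt; apply: nMt; exists i => //; exists j => //.
by rewrite /M ifN// neq_ltn ltn_ord.
Qed.

End transfer.

(* Fixing whole square blocks gives a pi-system, which the coordinate events of
   [array_cylinder] do not form; [set0] arises from incompatible blocks. *)
Definition array_pattern : set (set (nat -> nat -> bool)) :=
  [set C | C = set0 \/ exists n b,
    C = [set a | forall i j, (i < n)%N -> (j < n)%N -> a i j = b i j]].

(** Two blocks either agree on the smaller square, and the larger block is then the intersection, or
    they conflict and are disjoint. *)
Lemma array_patternI : setI_closed array_pattern.
Proof.
have sub n m (b c : nat -> nat -> bool) : (n <= m)%N ->
    let C := [set a | forall i j, (i < m)%N -> (j < m)%N -> a i j = c i j] in
    array_pattern
      ([set a | forall i j, (i < n)%N -> (j < n)%N -> a i j = b i j] `&` C).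
  move=> nm C; have [bc|bc] :=
    pselect (forall i j, (i < n)%N -> (j < n)%N -> b i j = c i j).
    right; exists m, c; rewrite setIidr// => a aC i j ni nj.
    by rewrite bc// aC// (leq_trans _ nm).
  left; apply/seteqP; split=> // a [ab ac]; apply: bc => i j ni nj.
  by rewrite -ab// ac// (leq_trans _ nm).
move=> C D [->|[n [b ->]]]; first by rewrite set0I => _; left.
move=> [->|[m [c ->]]]; first by rewrite setI0; left.
have [nm|/ltnW mn] := leqP n m; first exact: sub.
by rewrite setIC; exact: sub.
Qed.

Lemma measurable_array_coord i j b :
  measurable ([set a | a i j = b] : set array_measurableType).
Proof. by apply: sub_sigma_algebra; exists i, j, b. Qed.

Lemma measurable_array_pattern :
  array_pattern `<=` @measurable _ array_measurableType.
Proof.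
move=> _ [->|[n [b ->]]]; first exact: measurable0.
rewrite (_ : mkset _ = \bigcap_i \bigcap_j
    (if (i < n)%N && (j < n)%N
     then [set a : array_measurableType | a i j = b i j] else setT)).
  apply: bigcapT_measurable => i; apply: bigcapT_measurable => j.
  by case: ifP => // _; exact: measurable_array_coord.
apply/seteqP; split=> a /=.
  by move=> h i _ j _; case: ifPn => // /andP[]; exact: h.
by move=> h i j ni nj; have := h i I j I; rewrite ni nj.
Qed.

(** A coordinate event is the finite union of the square patterns, just large enough to contain the
    entry, that have the prescribed value there. *)
Lemma array_measurableE :
  @measurable _ array_measurableType = <<s array_pattern >>.
Proof.
apply/seteqP; split; last first.
  apply: smallest_sub; first exact: sigma_algebra_measurable.
  exact: measurable_array_pattern.
apply: smallest_sub; first exact: smallest_sigma_algebra.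
move=> _ [i [j [b ->]]]; pose n := (maxn i j).+1.
have iN : (i < n)%N by rewrite ltnS leq_maxl.
have jN : (j < n)%N by rewrite ltnS leq_maxr.
pose i0 : 'I_n := Ordinal iN; pose j0 : 'I_n := Ordinal jN.
(* Patterns are indexed by finite functions to make the union countable; [inord] reads them at
   natural indices. *)
pose C (p : {ffun 'I_n * 'I_n -> bool}) : set (nat -> nat -> bool) :=
  if p (i0, j0) == b then [set a | forall k l, (k < n)%N -> (l < n)%N ->
    a k l = p (inord k, inord l)] else set0.
rewrite (_ : mkset _ = \bigcup_p C p); last first.
  apply/seteqP; split=> a /=.
    move=> aij; exists [ffun kl : 'I_n * 'I_n => a kl.1 kl.2] => //.
    by rewrite /C ffunE/= aij eqxx => k l kn ln; rewrite ffunE/= !inordK.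
  move=> [p _]; rewrite /C; case: ifPn => // /eqP pb /(_ i j iN jN) ->.
  rewrite -pb; congr (p (_, _)); apply/val_inj; rewrite /= inordK//.
apply: (@countable_bigcupT_measurable _ (g_sigma_algebraType _)) => //.
move=> p; rewrite /C; case: ifP => _; last exact: measurable0.
by apply: sub_sigma_algebra; right; exists n, (fun k l => p (inord k, inord l)).
Qed.

(** It suffices to compare probabilities of patterns. Each is 0 or the integral of a likelihood that
    is a measurable function of the iid sequence, to which [iid_integral] applies. *)
Lemma array_law_unique (d1 d2 dS : measure_display) (T1 : measurableType d1)
    (T2 : measurableType d2) (S : measurableType dS)
    (P1 : probability T1 R) (P2 : probability T2 R) (F : probability S R)
    (X1 : nat -> {RV P1 >-> S}) (X2 : nat -> {RV P2 >-> S})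
    (w : S -> S -> R) (A1 : {RV P1 >-> array_measurableType})
    (A2 : {RV P2 >-> array_measurableType}) (E : set array_measurableType) :
  measurable_fun setT (fun z : S * S => w z.1 z.2) ->
  iid X1 F -> iid X2 F -> bernoulli_edges X1 w A1 -> bernoulli_edges X2 w A2 ->
  measurable E -> distribution P1 A1 E = distribution P2 A2 E.
Proof.
move=> mw iid1 iid2 [sym1 diag1 law1] [sym2 diag2 law2].
pose Q1 := distribution P1 A1; pose Q2 := distribution P2 A2.
apply: (@measure_unique _ R array_measurableType array_pattern (fun=> setT)
    array_measurableE array_patternI _ _ Q1 Q2).
- move=> _; right; exists 0%N, (fun _ _ => false).
  by apply/seteqP; split.
- by rewrite bigcup_const//; exists 0%N.
- move=> _ [->|[n [b ->]]]; first by rewrite !measure0.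
  rewrite /Q1 /Q2 /distribution /pushforward/=.
  (* A pattern that is not symmetric with zero diagonal is never realised; any other is determined
     by its entries above the diagonal. *)
  have [[symb diagb]|nb] := pselect
      ((forall i j, (i < n)%N -> (j < n)%N -> b j i = b i j) /\
       (forall i, (i < n)%N -> b i i = false)); last first.
    suff h T (A : T -> array_measurableType) :
        (forall t i j, A t j i = A t i j) -> (forall t i, A t i i = false) ->
        A @^-1` [set a | forall i j, (i < n)%N -> (j < n)%N -> a i j = b i j] =
        set0.
      by rewrite [LHS](congr1 P1 (h _ A1 sym1 diag1))
                 [RHS](congr1 P2 (h _ A2 sym2 diag2)) !measure0.
    move=> symA diagA; apply/seteqP; split=> // t /= At; apply: nb; split=> i.
      by move=> j ni nj; rewrite -!At.
    by move=> ni; rewrite -At.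
  have h T (A : T -> array_measurableType) :
      (forall t i j, A t j i = A t i j) -> (forall t i, A t i i = false) ->
      A @^-1` [set a | forall i j, (i < n)%N -> (j < n)%N -> a i j = b i j] =
      setT `&` [set t | forall i j, (i < j < n)%N -> A t i j = b i j].
    move=> symA diagA; rewrite setTI; apply/seteqP; split=> t /= At i j.
      by move=> /andP[ij jn]; apply: At => //; exact: ltn_trans jn.
    move=> ni nj; have [ij|ji|->] := ltngtP i j.
    - by apply: At; rewrite ij.
    - by rewrite symA -symb//; apply: At; rewrite ji.
    - by rewrite diagA diagb.
  (* Taking the whole space as conditioning event yields unconditional probabilities. *)
  have sT d (T : measurableType d) (P : probability T R)
      (X : nat -> {RV P >-> S}) : sigma_of X setT.
    by rewrite -(setD0 setT); apply: sigma_algebraCD; exact: sigma_algebra0.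
  rewrite [LHS](congr1 P1 (h _ A1 sym1 diag1)).
  rewrite [RHS](congr1 P2 (h _ A2 sym2 diag2)).
  rewrite law1// law2//.
  have mp i j : measurable_fun setT
      (fun x : @sequence_measurableType _ S => w (x i) (x j)).
    have mx : measurable_fun setT
        (fun x : @sequence_measurableType _ S => (x i, x j)).
      by apply: measurable_fun_pair; exact: measurable_seq_coord.
    exact: (measurableT_comp mw mx).
  exact: (iid_integral iid1 iid2 (measurable_edges_likelihood n b mp)).
- by move=> _; rewrite (le_lt_trans (probability_le1 _ _))// ltry.
Qed.

End edges.

(** The product of two image laws is the image of the product, so the claim becomes one about
    uniform pairs, which lie in the unit square and outside [N] almost surely. *)
Lemma graph_root_distribution_map (R : realType)
    (g : measurableTypeR R -> krein_borel R) (mg : measurable_fun setT g)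
    (N : set (R * R)) :
  measurable N ->
  (uniform_prob (@ltr01 R) \x uniform_prob (@ltr01 R))%E N = 0%E ->
  (forall s s', unit_itv R s -> unit_itv R s' -> ~ N (s, s') ->
    0 <= krein_dot (g s) (g s') <= 1) ->
  graph_root_distribution (distribution (uniform_prob (@ltr01 R)) (mfun_of mg)).
Proof.
move=> mN N0 g01.
have mgB B : measurable B -> measurable (g @^-1` B).
  by move=> mB; rewrite -[X in measurable X]setTI; exact: mg.
set U := uniform_prob _ in N0 *; set F := distribution _ _.
have mkd : measurable_fun setT
    (fun z : krein_borel R * krein_borel R => krein_dot z.1 z.2).
  by apply: measurable_krein_dot; [exact: measurable_fst|exact: measurable_snd].
pose h (z : measurableTypeR R * measurableTypeR R) := (g z.1, g z.2).
have mh : measurable_fun setT h.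
  apply: measurable_fun_pair.
    exact: (measurableT_comp mg measurable_fst).
  exact: (measurableT_comp mg measurable_snd).
pose K := [set z : krein_borel R * krein_borel R | 0 <= krein_dot z.1 z.2 <= 1].
have mK : measurable K.
  rewrite (_ : K = (fun z => krein_dot z.1 z.2) @^-1` `[0, 1]%classic).
    by rewrite -[X in measurable X]setTI; apply: mkd => //;
      exact: measurable_itv.
  by apply/seteqP; split=> z /=; rewrite in_itv.
have mhK : measurable (h @^-1` K).
  by rewrite -[X in measurable X]setTI; exact: mh.
have mII : measurable (unit_itv R `*` unit_itv R).
  by apply: measurableX; exact: measurable_itv.
change ((F \x F)%E K = 1%E).
have -> : (F \x F)%E K = (U \x U)%E (h @^-1` K).
  pose m := distribution (U \x U)%E (mfun_of mh).
  apply: (@product_measure_unique _ _ _ _ R F F m) => // A B mA mB.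
  by apply: (@product_measure1E _ _ _ _ R U U (g @^-1` A) (g @^-1` B));
    exact: mgB.
have UI : U (unit_itv R) = 1%E.
  apply: etrans (uniform_probE _) _; first exact: measurable_itv.
  by rewrite setIid lebesgue_measure_itv/= lte_fin ltr01 oppr0 adde0.
have UII : (U \x U)%E (unit_itv R `*` unit_itv R) = 1%E.
  rewrite product_measure1E; [|exact: measurable_itv|exact: measurable_itv].
  exact: etrans (congr1 (fun x => (x * x)%E) UI) (mule1 1%E).
apply/eqP; rewrite eq_le probability_le1//=.
(* The unit square has mass 1 and is covered by the favourable pairs together with the null set
   [N]. *)
rewrite -UII; apply: (@le_trans _ _ ((U \x U)%E (h @^-1` K `|` N))).
  apply: le_measure; rewrite ?inE//; first exact: measurableU.
  move=> [s s'] [/= Is Is'].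
  have [Ns|nNs] := pselect (N (s, s')); first by right.
  by left; exact: g01.
rewrite -[leRHS]adde0 -N0; exact: measureU2.
Qed.

Theorem theorem3p1 (R : realType) (W : R -> R -> R) :
  graphon W -> strong_spectral_decomposition W ->
  exists F : probability (krein_borel R) R,
    [/\ graph_root_distribution F,
        forall mu : probability array_measurableType R,
          graphon_sampling_law W mu -> graph_root_sampling_law F mu &
        forall mu nu : probability array_measurableType R,
          graphon_sampling_law W mu -> graph_root_sampling_law F nu ->
          forall E : set array_measurableType, measurable E -> mu E = nu E].
Proof.
move=> gW [lam [gam [phi [psi [dW sW]]]]].
have mg : measurable_fun setT
    (krein_root lam gam phi psi : measurableTypeR R -> _).
  exact: measurable_krein_root dW.
have [N [mN N0 WN]] := graphon_root_ae gW dW sW.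
have [mW _ W01] := gW.
have mkd : measurable_fun setT
    (fun z : krein_borel R * krein_borel R => krein_dot z.1 z.2).
  by apply: measurable_krein_dot; [exact: measurable_fst|exact: measurable_snd].
exists (distribution (uniform_prob (@ltr01 R)) (mfun_of mg)).
set F := distribution _ _.
(* The probability space and the array stay the same; only the vertex labels are replaced by their
   roots. *)
have transfer mu : graphon_sampling_law W mu -> graph_root_sampling_law F mu.
  move=> [d [T [P [s [A [sI iids edges law]]]]]].
  (* [uniform_prob] lives on [measurableTypeR R], whose display differs from
     that of the default measurable structure of [R]: the sample is recast. *)
  have ms i : measurable_fun setT (s i : T -> measurableTypeR R).
    have si : measurable_fun setT (s i) by exact: measurable_funPT.
    exact: si.
  pose s' i : {RV P >-> measurableTypeR R} := mfun_of (ms i).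
  have iids' : iid s' (uniform_prob (@ltr01 R)) by exact: iids.
  have edges' : bernoulli_edges s' W A by exact: edges.
  exists d, T, P, (rv_map s' mg), A; split => //; first exact: iid_rv_map.
  have mss i j : measurable_fun setT (fun t => (s i t, s j t)).
    by apply: measurable_fun_pair; exact: measurable_funPT.
  apply: (bernoulli_edges_rv_map mg iids' mN N0 _ _ _ edges').
  - by move=> t i j nN; apply: WN => //; exact: sI.
  - move=> i j.
    (* [W] is measurable on the unit square only, so the sample must be known to stay in it. *)
    apply: (measurable_comp _ _ mW (mss i j)).
      by apply: measurableX; exact: measurable_itv.
    by move=> _ [t _ <-]; split; exact: sI.
  - by move=> i j; apply: measurable_krein_dot; exact: (measurableT_comp mg).
split => //.
  apply: (graph_root_distribution_map mg mN N0) => s s' Is Is' nN.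
  by rewrite -WN//; exact: W01.
(* Once [mu] is seen as a law of sampling with [F], uniqueness identifies it with [nu]. *)
move=> mu nu /transfer[d1 [T1 [P1 [X1 [A1 [iid1 edges1 law1]]]]]].
move=> [d2 [T2 [P2 [X2 [A2 [iid2 edges2 law2]]]]]] E mE.
rewrite -law1// -law2//.
exact: (array_law_unique mkd iid1 iid2 edges1 edges2 mE).
Qed.
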